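(* Let $(P,A,\lambda)$ be a marked poset. Define $\tilde\phi:\mathbf{R}^{P-A}\to\mathbf{R}^{P-A}$ by \[ \tilde\phi(x)_p=\min\Bigl(\{x_p-x_q \mid p\succ q,\ q\notin A\}\cup\{x_p-\lambda_q \mid p\succ q,\ q\in A\}\Bigr)\qquad (p\in P-A). \] Then $\tilde\phi$ restricts to a continuous, piecewise affine bijection from the marked order polytope $\mathcal{O}(P,A)_\lambda$ onto the marked chain polytope $\mathcal{C}(P,A)_\lambda$.
   Context: A marked poset $(P,A,\lambda)$ consists of a finite poset $P$, a subset $A\subseteq P$ containing all maximal and all minimal elements of $P$, and a vector $\lambda=(\lambda_a)_{a\in A}\in\mathbf{R}^A$. For $p,q\in P$, $p\succ q$ means $p$ covers $q$: $p>q$ and there is no $r\in P$ with $p>r>q$. The marked order polytope is $\mathcal{O}(P,A)_\lambda=\{x\in\mathbf{R}^{P-A}\mid x_p\le x_q \text{ for } p<q;\ \lambda_a\le x_p \text{ for } a<p;\ x_p\le\lambda_a \text{ for } p<a\}$, where $p,q$ range over $P-A$ and $a$ over $A$. The marked chain polytope is $\mathcal{C}(P,A)_\lambda=\{x\in\mathbf{R}_{\ge0}^{P-A}\mid x_{p_1}+\cdots+x_{p_k}\le\lambda_b-\lambda_a \text{ whenever } a<p_1<\cdots<p_k<b\}$, where $a,b\in A$ and $p_1,\dots,p_k\in P-A$.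
   Formalization: The formal theorem additionally assumes that λ is order-preserving on A (a ≤ b implies λ_a ≤ λ_b); for arbitrary λ the claim fails, e.g. for the chain a1<a2<p<b with A={a1,a2,b} and λ=(5,0,10). *)

(* Defs.v *)
From HB Require Export structures.
From mathcomp Require Export all_boot all_order all_algebra.
From mathcomp Require Export all_classical all_reals all_analysis.
Export Order.TTheory GRing.Theory Num.Theory.
Export numFieldNormedType.Exports.

Set Implicit Arguments.
Unset Strict Implicit.
Unset Printing Implicit Defensive.

Local Open Scope classical_set_scope.
Local Open Scope ring_scope.

Notation marked A := {a | a \in A}.
Notation unmarked A := {p | p \notin A}.

(* R^I for a finite index type I, with the product topology *)
Notation "''R^' ( R , I )" := {ptws I -> R}
  (at level 8, only parsing) : type_scope.

Section Posets.
Context (d : Order.disp_t) (P : finPOrderType d).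
Implicit Types (p q : P) (A : {set P}).

Definition covers p q : bool :=
  (q < p)%O && [forall r, ~~ ((q < r)%O && (r < p)%O)].

Definition is_minimal p : bool := [forall q, ~~ (q < p)%O].
Definition is_maximal p : bool := [forall q, ~~ (p < q)%O].

Definition contains_extremal A : Prop :=
  forall p, is_minimal p || is_maximal p -> p \in A.

End Posets.

Section MarkedPolytopes.
Context (R : realType) (d : Order.disp_t) (P : finPOrderType d) (A : {set P}).
Variable lam : marked A -> R.
Implicit Types (x : 'R^(R, unmarked A)).

Definition order_polytope : set 'R^(R, unmarked A) :=
  [set x | [/\ forall p q : unmarked A, (val p < val q)%O -> x p <= x q,
               forall (a : marked A) (p : unmarked A),
                 (val a < val p)%O -> lam a <= x p
             & forall (a : marked A) (p : unmarked A),
                 (val p < val a)%O -> x p <= lam a]].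

(* [path <%O a (p_1 ... p_k b)] is the chain a < p_1 < ... < p_k < b, k >= 1 *)
Definition chain_polytope : set 'R^(R, unmarked A) :=
  [set x | (forall p, 0 <= x p) /\
     forall (a b : marked A) (s : seq (unmarked A)), s != [::] ->
       path <%O%O (val a) (rcons (map val s) (val b)) ->
       \sum_(p <- s) x p <= lam b - lam a].

(* the minimum of a nonempty sequence (junk value 0 on the empty one) *)
Definition seq_min (s : seq R) : R := \big[Num.min/head 0 s]_(y <- s) y.

Lemma seq_min_in (s : seq R) : s != [::] -> seq_min s \in s.
Proof.
case: s => // z s _; rewrite /seq_min big_seq; elim/big_ind: _ => [|u v hu hv|//]; first exact: mem_head.
by rewrite minEle; case: ifP.
Qed.

Lemma seq_min_le (s : seq R) y : y \in s -> seq_min s <= y.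
Proof. by move=> ys; exact: bigmin_inf_seq ys _ _. Qed.

(* If p is unmarked and [contains_extremal A], p is not minimal, so the
   sequence below is nonempty. *)
Definition phi_tilde x : 'R^(R, unmarked A) := fun p =>
  seq_min ([seq x p - x q | q <- enum {: unmarked A} & covers (val p) (val q)]
        ++ [seq x p - lam a | a <- enum {: marked A} & covers (val p) (val a)]).

End MarkedPolytopes.

Section PiecewiseAffine.
Context (R : realType) (I J : finType).

Definition polyhedron (Q : set 'R^(R, I)) : Prop :=
  exists (m : nat) (c : 'I_m -> I -> R) (b : 'I_m -> R),
    Q = [set x | forall k, \sum_i c k i * x i <= b k].

Definition affine_map (g : 'R^(R, I) -> 'R^(R, J)) : Prop :=
  exists (M : J -> I -> R) (b : J -> R),
    forall x j, g x j = \sum_i M j i * x i + b j.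

(* D is a finite union of polyhedra on each of which f is affine *)
Definition piecewise_affine (D : set 'R^(R, I))
    (f : 'R^(R, I) -> 'R^(R, J)) : Prop :=
  exists (n : nat) (Q : 'I_n -> set 'R^(R, I))
         (g : 'I_n -> 'R^(R, I) -> 'R^(R, J)),
    [/\ forall i, polyhedron (Q i),
        forall i, affine_map (g i),
        D = \bigcup_i Q i
      & forall i x, Q i x -> f x = g i x].

End PiecewiseAffine.

(* Main.v *)
Require Import Defs.

(* Extend x in R^(P-A) to P by lam on A. The order polytope is the set of x whose
   extension is monotone, and phi_tilde x p = x p - max, the maximum being that
   of the extended x over the elements covered by p. Hence x can be recovered
   from phi_tilde x by recursion along the order, and phi_tilde is a bijection
   of the whole space R^(P-A). If the extension is monotone, the sums in the
   chain inequalities telescope. Conversely, following the elements that attain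
   the maximum from p down to A expresses x p as lam a plus the sum of
   phi_tilde x along a chain from a to p, so that the chain inequalities give
   x p <= lam b for every marked b > p; nonnegativity of phi_tilde x gives
   monotonicity below unmarked elements. *)

Set Implicit Arguments.
Unset Strict Implicit.
Unset Printing Implicit Defensive.

Local Open Scope classical_set_scope.
Local Open Scope ring_scope.

(** * Covering relations and induction in a finite poset *)

Section PosetRank.
Context (d : Order.disp_t) (P : finPOrderType d).
Implicit Types p q r : P.

(** A strictly monotone rank, used as the measure for induction along the order. *)
Definition below_card p : nat := #|[set q | (q < p)%O]|%SET.

Lemma below_card_lt q p : (q < p)%O -> (below_card q < below_card p)%N.
Proof.
move=> qp; apply/proper_card/properP; split.
  by apply/fintype.subsetP => r; rewrite !inE => /lt_trans; exact.
by exists q; rewrite !inE// ltxx.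
Qed.

Lemma covers_lt p q : covers p q -> (q < p)%O.
Proof. by case/andP. Qed.

Lemma lt_covers q p : (q < p)%O -> exists2 r, covers p r & (q <= r)%O.
Proof.
move=> qp.
have Pq : ((q <= q) && (q < p))%O by rewrite lexx.
(* An element of maximal rank in the interval from [q] up to but excluding [p] is covered by [p]:
   anything strictly between would have larger rank. *)
case: (@arg_maxnP _ q (fun t => (q <= t < p)%O) below_card Pq) => r /andP[qr rp] rmax.
exists r => //; rewrite /covers rp; apply/forallP => t.
apply/negP => /andP[rt tp].
have /rmax : ((q <= t) && (t < p))%O by rewrite tp (le_trans qr (ltW rt)).
by rewrite /= leqNgt below_card_lt.
Qed.

Lemma order_ind (K : P -> Prop) :
  (forall p, (forall q, (q < p)%O -> K q) -> K p) -> forall p, K p.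
Proof.
move=> step p; have [n] := ubnP (below_card p).
elim: n => // n IH in p *; rewrite ltnS => pn.
by apply: step => q qp; apply: IH; exact: leq_trans (below_card_lt qp) pn.
Qed.

End PosetRank.

(** * Polyhedra and piecewise affine maps indexed by arbitrary finite types *)

Section FinitePolyhedra.
Context (R : realType) (I : finType).
Implicit Types (l : 'R^(R, I) -> R).

Definition affine_form l : Prop :=
  exists (c : I -> R) (b : R), forall x, l x = \sum_i c i * x i + b.

Lemma affine_form_cst (b : R) : affine_form (fun=> b).
Proof.
exists (fun=> 0), b => x; rewrite big1 ?add0r// => i _.
by rewrite mul0r.
Qed.

Lemma affine_form_coord (i : I) : affine_form (fun x => x i).
Proof.
exists (fun j => (j == i)%:R), 0 => x; rewrite addr0 (bigD1 i)//= eqxx mul1r.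
by rewrite big1 ?addr0// => j /negbTE ->; rewrite mul0r.
Qed.

Lemma affine_formB l l' :
  affine_form l -> affine_form l' -> affine_form (fun x => l x - l' x).
Proof.
move=> [c [b lE]] [c' [b' lE']]; exists (fun i => c i - c' i), (b - b') => x.
rewrite lE lE' opprD addrACA -sumrB; congr (_ + _).
by apply: eq_bigr => i _; rewrite mulrBl.
Qed.

Lemma polyhedron_affine_forms (K : finType) (l : K -> 'R^(R, I) -> R) :
  (forall k, affine_form (l k)) -> polyhedron [set x | forall k, l k x <= 0].
Proof.
move=> /choice[c] /choice[b lE].
exists #|K|, (fun k => c (enum_val k)), (fun k => - b (enum_val k)).
apply/seteqP; split=> x /= H k.
  by rewrite -subr_le0 opprK -lE.
by have := H (enum_rank k); rewrite enum_rankK -subr_le0 opprK -lE.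
Qed.

Lemma affine_map_forms (J : finType) (g : 'R^(R, I) -> 'R^(R, J)) :
  (forall j, affine_form (fun x => g x j)) -> affine_map g.
Proof. by move=> /choice[M] /choice[b gE]; exists M, b => x j; exact: gE. Qed.

Lemma piecewise_affine_fin (J T : finType) (D : set 'R^(R, I))
    (f : 'R^(R, I) -> 'R^(R, J)) (Q : T -> set 'R^(R, I))
    (g : T -> 'R^(R, I) -> 'R^(R, J)) :
  (forall t, polyhedron (Q t)) -> (forall t, affine_map (g t)) ->
  D = \bigcup_t Q t -> (forall t x, Q t x -> f x = g t x) ->
  piecewise_affine D f.
Proof.
move=> Qp ga DQ fg.
exists #|T|, (fun i => Q (enum_val i)), (fun i => g (enum_val i)); split => //.
- rewrite DQ; apply/seteqP; split=> x [t _ Qx]; last by exists (enum_val t).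
  by exists (enum_rank t) => //; rewrite enum_rankK.
- by move=> i x; exact: fg.
Qed.

End FinitePolyhedra.

(** * Continuity into a product and of finite minima *)

Section Continuity.
Context (R : realType).

Lemma continuous_ptws (T : topologicalType) (I : eqType)
    (f : T -> 'R^(R, I)) :
  (forall i, continuous (fun x => f x i)) -> continuous f.
Proof.
move=> cf x; apply/cvg_sup => i; move: x.
exact: (@continuous_comp_initial _ T R (fun g : I -> R => g i) f (cf i)).
Qed.

Lemma seq_min_continuous (T : topologicalType) (s : seq (T -> R)) :
  (forall g, g \in s -> continuous g) ->
  continuous (fun x => seq_min [seq g x | g <- s]).
Proof.
move=> cs; rewrite /seq_min.
have ch : continuous (fun x => head 0 [seq g x | g <- s]).
  case: s cs => [|g s] cs /=; first exact: cst_continuous.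
  exact/cs/mem_head.
(* The default value [head 0] changes with the list, so the induction is run with an arbitrary fixed
   continuous default [h]. *)
suff bigmin_continuous h : continuous h ->
    continuous (fun x => \big[Num.min/h x]_(g <- s) g x).
  by under eq_fun do rewrite big_map; exact: bigmin_continuous ch.
move=> {}ch; elim: s cs => [|g s IH] cs.
  by under eq_fun do rewrite big_nil.
under eq_fun do rewrite big_cons.
apply: (@min_fun_continuous _ _ _ g).
  exact/cs/mem_head.
by apply: IH => k ks; apply: cs; rewrite in_cons ks orbT.
Qed.

End Continuity.

(** * Extension of a point to the whole poset *)

Section MarkedOrderChain.
Context (R : realType) (d : Order.disp_t) (P : finPOrderType d) (A : {set P}).
Variable lam : marked A -> R.
Implicit Types (x y : 'R^(R, unmarked A)) (p : unmarked A) (a b : marked A).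
Implicit Types (q r : P).

(** The final 0 is never reached: every element is marked or unmarked. *)
Definition extend x q : R :=
  if insub q is Some p then x p else
  if insub q is Some a then lam a else 0.

Lemma extend_unmarked x p : extend x (val p) = x p.
Proof. by rewrite /extend valK. Qed.

Lemma extend_marked x a : extend x (val a) = lam a.
Proof. by rewrite /extend insubN ?negbK ?valK// (valP a). Qed.

Variant marking_spec q : Prop :=
  | IsUnmarked p of q = val p
  | IsMarked a of q = val a.

Lemma markingP q : marking_spec q.
Proof.
have [qA|qA] := boolP (q \in A); first exact: (@IsMarked _ (Sub q qA)).
exact: (@IsUnmarked _ (Sub q qA)).
Qed.

Lemma affine_form_extend q : affine_form (extend^~ q).
Proof.
case: (markingP q) => [p|a] ->.
  rewrite (funext (extend_unmarked^~ p)); exact: affine_form_coord.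
rewrite (funext (extend_marked^~ a)); exact: affine_form_cst.
Qed.

Lemma extend_continuous q : continuous (extend^~ q).
Proof.
case: (markingP q) => [p|a] ->.
  rewrite (funext (extend_unmarked^~ p)).
  exact: (@proj_continuous _ (fun=> R) p).
rewrite (funext (extend_marked^~ a)); exact: cst_continuous.
Qed.

(** Comparing two marked elements is the only case outside the defining inequalities; there
    monotonicity of [lam] is used. *)
Lemma order_polytopeE :
  (forall a b, (val a <= val b)%O -> lam a <= lam b) ->
  order_polytope lam =
  [set x | forall q r, (q < r)%O -> extend x q <= extend x r].
Proof.
move=> hlam; apply/seteqP; split=> x /=.
  case=> xx ax xa q r; case: (markingP q) => [p|a] ->;
    case: (markingP r) => [p'|a'] ->; rewrite ?(extend_unmarked, extend_marked).
  - exact: xx.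
  - exact: xa.
  - exact: ax.
  - by move=> /ltW; exact: hlam.
move=> mono; split=> [p p'|a p|a p] /mono;
  by rewrite ?(extend_unmarked, extend_marked).
Qed.

Hypothesis hA : contains_extremal A.

Lemma unmarked_covers p : exists q, covers (val p) q.
Proof.
have /existsP[q qp] : [exists q, (q < val p)%O].
  apply: contraT; rewrite negb_exists => minp.
  by have := valP p; rewrite hA // /is_minimal minp.
by have [r pr _] := lt_covers qp; exists r.
Qed.

(** Through [extend], the two lists under the minimum become one family indexed by the elements that
    [p] covers. *)
Lemma mem_phi_tilde_seq x p (v : R) :
  v \in ([seq x p - x p' | p' <- enum {: unmarked A} & covers (val p) (val p')]
     ++ [seq x p - lam a | a <- enum {: marked A} & covers (val p) (val a)]) <->
  exists2 q, covers (val p) q & v = x p - extend x q.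
Proof.
rewrite mem_cat; split.
  case/orP=> /mapP[q]; rewrite mem_filter => /andP[pq _] ->.
    by exists (val q); rewrite ?extend_unmarked.
  by exists (val q); rewrite ?extend_marked.
move=> [q + ->]; case: (markingP q) => [p'|a] -> pq; apply/orP; [left|right].
  apply/mapP; exists p'; rewrite ?extend_unmarked//.
  by rewrite mem_filter pq mem_enum.
apply/mapP; exists a; rewrite ?extend_marked//.
by rewrite mem_filter pq mem_enum.
Qed.

Lemma phi_tilde_attained x p :
  exists2 q, covers (val p) q & phi_tilde lam x p = x p - extend x q.
Proof.
apply/mem_phi_tilde_seq/seq_min_in; apply/negP => /eqP s0.
have [q pq] := unmarked_covers p.
have /mem_phi_tilde_seq : exists2 q', covers (val p) q' &
  x p - extend x q = x p - extend x q' by exists q.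
by rewrite s0.
Qed.

Lemma phi_tilde_le x p q :
  covers (val p) q -> phi_tilde lam x p <= x p - extend x q.
Proof. by move=> pq; apply/seq_min_le/mem_phi_tilde_seq; exists q. Qed.

(** * Continuity and piecewise affinity of [phi_tilde] *)

Lemma phi_tilde_continuous : continuous (phi_tilde lam).
Proof.
apply: continuous_ptws => p.
pose s := [seq (fun x => x p - extend x (val p'))
            | p' <- enum {: unmarked A} & covers (val p) (val p')]
       ++ [seq (fun x => x p - extend x (val a))
            | a <- enum {: marked A} & covers (val p) (val a)].
rewrite (_ : (fun x => _) = fun x => seq_min [seq g x | g <- s]); last first.
  apply/funext => x; rewrite /phi_tilde /s map_cat -!map_comp.
  congr (seq_min (_ ++ _)); apply: eq_map => q /=.
    by rewrite extend_unmarked.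
  by rewrite extend_marked.
have coordB q : continuous (fun x => x p - extend x q).
  move=> x; apply: (@continuousB _ R^o); last exact: extend_continuous.
  exact: (@proj_continuous _ (fun=> R) p).
apply: seq_min_continuous => g; rewrite mem_cat.
by case/orP => /mapP[q _ ->]; exact: coordB.
Qed.

(* On the piece indexed by f, the maximum of the extended x over the elements
   covered by p is attained at f p. *)
Lemma phi_tilde_piecewise_affine :
  (forall a b, (val a <= val b)%O -> lam a <= lam b) ->
  piecewise_affine (order_polytope lam) (phi_tilde lam).
Proof.
move=> hlam.
pose T := {ffun unmarked A -> P}.
(* Each piece is cut out by [form f k x <= 0]. The value 0 makes an index vacuous; the value 1
   empties the piece when some [f p] is not covered by [p]. *)
pose form (f : T) (k : P * P + unmarked A * P) x : R :=
  match k with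
  | inl (q, r) => if (q < r)%O then extend x q - extend x r else 0
  | inr (p, q) => if ~~ covers (val p) (f p) then 1 else
      if covers (val p) q then extend x q - extend x (f p) else 0
  end.
pose g (f : T) x : 'R^(R, unmarked A) := fun p => x p - extend x (f p).
apply: (@piecewise_affine_fin _ _ _ T _ _
  (fun f => [set x | forall k, form f k x <= 0]) g).
- move=> f; apply: polyhedron_affine_forms => -[[q r]|[p q]]; rewrite /form.
    case: (q < r)%O; last exact: affine_form_cst.
    by apply: affine_formB; exact: affine_form_extend.
  case: (covers (val p) (f p)) => /=; last exact: affine_form_cst.
  case: (covers (val p) q); last exact: affine_form_cst.
  by apply: affine_formB; exact: affine_form_extend.
- move=> f; apply: affine_map_forms => p; apply: affine_formB.
    exact: affine_form_coord.
  exact: affine_form_extend.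
- rewrite order_polytopeE//; apply/seteqP; split => x /=.
    move=> mono; have /choice[h hP] : forall p, exists q,
      covers (val p) q /\ phi_tilde lam x p = x p - extend x q.
      by move=> p; have [q pq phiE] := phi_tilde_attained x p; exists q.
    exists [ffun p => h p] => //= -[[q r]|[p q]] /=.
      by case: ifP => // /mono; rewrite subr_le0.
    rewrite ffunE; have [-> /= phiE] := hP p; case: ifP => // pq.
    by have := phi_tilde_le x pq; rewrite phiE lerD2l lerN2 subr_le0.
  move=> [f _ fx] q r qr; have /= := fx (inl (q, r)).
  by rewrite qr subr_le0.
- move=> f x fx; apply/funext => p; rewrite /g.
  have [q pq phiE] := phi_tilde_attained x p.
  have /= := fx (inr (p, q)); case: ifPn => [|]; first by rewrite ler10.
  rewrite negbK pq subr_le0 => pf xq; apply/eqP; rewrite eq_le phi_tilde_le//=.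
  by rewrite phiE lerD2l lerN2.
Qed.

(** * From the order polytope to the chain polytope *)

Lemma phi_tilde_le_lt x p q :
  (forall q r, (q < r)%O -> extend x q <= extend x r) ->
  (q < val p)%O -> phi_tilde lam x p <= x p - extend x q.
Proof.
move=> mono qp; have [r pr qr] := lt_covers qp.
apply: le_trans (phi_tilde_le x pr) _; rewrite lerD2l lerN2.
by move: qr; rewrite le_eqVlt => /predU1P[->//|/mono].
Qed.

(** Each term is at most the increment of the extended [x] along the chain. The start [q] is
    arbitrary so that the induction can move it up to the next element. *)
Lemma phi_tilde_chain x q b (s : seq (unmarked A)) :
  (forall q r, (q < r)%O -> extend x q <= extend x r) ->
  path <%O%O q (rcons (map val s) (val b)) ->
  \sum_(p <- s) phi_tilde lam x p <= lam b - extend x q.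
Proof.
move=> mono; elim: s q => [|p s IH] q /=.
  by rewrite andbT big_nil subr_ge0 -(extend_marked x) => /mono.
move=> /andP[qp /IH IHp]; rewrite big_cons.
apply: le_trans (lerD (phi_tilde_le_lt mono qp) IHp) _.
by rewrite extend_unmarked addrC addrA subrK.
Qed.

Lemma phi_tilde_chain_polytope x :
  (forall q r, (q < r)%O -> extend x q <= extend x r) ->
  chain_polytope lam (phi_tilde lam x).
Proof.
move=> mono; split=> [p|a b s _ ch].
  have [q pq ->] := phi_tilde_attained x p.
  by rewrite subr_ge0 -(extend_unmarked x p) mono// covers_lt.
by rewrite -(extend_marked x a) phi_tilde_chain.
Qed.

(** * Bijectivity of [phi_tilde] on the whole space *)

(* [x p - phi_tilde lam x p] is the maximum of the extended x over the elements
   covered by p. *)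
Lemma sub_phi_tilde_local x y p :
  (forall q, (q < val p)%O -> extend x q = extend y q) ->
  x p - phi_tilde lam x p = y p - phi_tilde lam y p.
Proof.
(* By symmetry one inequality suffices: an element attaining the maximum for [x'] is a competitor in
   the maximum for [y']. *)
have half x' y' : (forall q, (q < val p)%O -> extend x' q = extend y' q) ->
    x' p - phi_tilde lam x' p <= y' p - phi_tilde lam y' p.
  move=> xy; have [q pq ->] := phi_tilde_attained x' p.
  rewrite subKr xy ?covers_lt// lerBrDr addrC -lerBrDr.
  exact: phi_tilde_le.
move=> xy; apply/eqP; rewrite eq_le !half// => q qp.
by rewrite xy.
Qed.

Lemma phi_tilde_inj x y : phi_tilde lam x = phi_tilde lam y -> x = y.
Proof.
move=> phixy.
have ext_eq q : extend x q = extend y q.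
  elim/order_ind: q => q IH.
  case: (markingP q) => [p|a] qE; rewrite qE ?extend_marked//.
  rewrite !extend_unmarked.
  have /sub_phi_tilde_local : forall r, (r < val p)%O ->
    extend x r = extend y r by rewrite -qE.
  by rewrite phixy => /addIr.
by apply/funext => p; rewrite -!extend_unmarked.
Qed.

Lemma phi_tilde_surj y : exists x, phi_tilde lam x = y.
Proof.
(* The preimage is built rank by rank; all ranks are at most [#|P|]. *)
suff /(_ #|P|.+1)[x xP] : forall n, exists x, forall p,
    (below_card (val p) < n)%N -> phi_tilde lam x p = y p.
  by exists x; apply/funext => p; apply: xP; rewrite ltnS max_card.
elim=> [|n [x xP]]; first by exists y.
(* At rank [n], the new value is [y p] plus the maximum over the covered elements, which have
   smaller rank and keep their values. *)
pose x' : 'R^(R, unmarked A) := fun p =>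
  if (below_card (val p) < n)%N then x p else y p + (x p - phi_tilde lam x p).
exists x' => p; rewrite ltnS => pn.
have /sub_phi_tilde_local E : forall q, (q < val p)%O ->
    extend x q = extend x' q.
  move=> q /below_card_lt qp; case: (markingP q) => [p'|a] qE.
    by rewrite qE !extend_unmarked /x' -qE (leq_trans qp).
  by rewrite qE !extend_marked.
have : x' p = y p + (x p - phi_tilde lam x p).
  rewrite /x'; case: ifP => // /xP <-.
  by rewrite addrC subrK.
rewrite E => x'E; apply: (@addIr _ (x' p - phi_tilde lam x' p)).
by rewrite -x'E addrC subrK.
Qed.

(** * From the chain polytope back to the order polytope *)

Lemma extend_le_covers x p q : 0 <= phi_tilde lam x p ->
  covers (val p) q -> extend x q <= x p.
Proof. by move=> phi0 pq; rewrite -subr_ge0 (le_trans phi0)// phi_tilde_le. Qed.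

Lemma phi_tilde_chainE x p : exists a (s : seq (unmarked A)),
  path <%O%O (val a) (rcons (map val s) (val p)) /\
  x p = lam a + \sum_(p' <- rcons s p) phi_tilde lam x p'.
Proof.
(* [val p] is named [q] because [order_ind] runs over [P], not over the unmarked elements. *)
have [q] : exists q, q = val p by exists (val p).
elim/order_ind: q p => q IH p qE.
have [r pr phiE] := phi_tilde_attained x p.
have xE : x p = extend x r + phi_tilde lam x p by rewrite phiE addrC subrK.
have rp := covers_lt pr.
case: (markingP r) => [p'|a] rE; last first.
  exists a, [::]; rewrite /= andbT -rE; split => //.
  by rewrite big_seq1 xE rE extend_marked.
have [||a [s [ch sE]]] := IH r _ p' => //; first by rewrite qE.
exists a, (rcons s p'); split.
  by rewrite map_rcons rcons_path ch last_rcons -rE.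
by rewrite big_rcons /= addrA -sE xE rE extend_unmarked.
Qed.

(** Induction on the upper element [r]. If it is unmarked, nonnegativity allows a step down to a
    covered element above or equal to [q]; if it is marked and [q] is not, the chain ending at [q]
    is closed off by [r]. *)
Lemma chain_polytope_extend_mono x :
  (forall a b, (val a <= val b)%O -> lam a <= lam b) ->
  chain_polytope lam (phi_tilde lam x) ->
  forall q r, (q < r)%O -> extend x q <= extend x r.
Proof.
move=> hlam [phi0 phic] q r; elim/order_ind: r q => r IH q.
case: (markingP r) => [p|b] rE.
  rewrite [in extend _ r]rE extend_unmarked rE => /lt_covers[t pt].
  rewrite le_eqVlt => /predU1P[->|qt]; first exact: extend_le_covers.
  apply: le_trans (IH t _ q qt) _; first by rewrite rE covers_lt.
  exact: extend_le_covers.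
rewrite rE extend_marked; case: (markingP q) => [p|a] ->; last first.
  by rewrite extend_marked => /ltW; exact: hlam.
rewrite extend_unmarked => pb; have [a [s [ch ->]]] := phi_tilde_chainE x p.
rewrite addrC -lerBrDr; apply: phic; first by case: (s).
by rewrite map_rcons rcons_path ch last_rcons.
Qed.

End MarkedOrderChain.

Theorem theorem3p4 (R : realType) (d : Order.disp_t) (P : finPOrderType d)
    (A : {set P}) (lam : marked A -> R)
    (hA : contains_extremal A)
    (hlam : forall a b : marked A, (val a <= val b)%O -> lam a <= lam b) :
  [/\ {within order_polytope lam, continuous (phi_tilde lam)},
      piecewise_affine (order_polytope lam) (phi_tilde lam)
    & set_bij (order_polytope lam) (chain_polytope lam) (phi_tilde lam)].
Proof.
split.
- exact/continuous_subspaceT/phi_tilde_continuous.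
- exact: phi_tilde_piecewise_affine.
- rewrite order_polytopeE//; split.
  + by move=> x /=; exact: phi_tilde_chain_polytope.
  + by move=> x y _ _; exact: phi_tilde_inj.
  (* The preimage in the whole space lies in the order polytope because its image satisfies the
     chain inequalities. *)
  + move=> y yC; have [x xy] := phi_tilde_surj lam hA y; exists x => //=.
    by apply: chain_polytope_extend_mono => //; rewrite xy.
Qed.
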